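(* Let $n\ge1$ be an integer, $\epsilon\in(0,1)$ and $t\in\mathbf{R}$. There is a constant $C_{n,\epsilon,t}>0$, depending only on $n$, $\epsilon$ and $t$, such that the following holds. Let $\sigma$ be a pre-stability condition on a $k$-linear triangulated category $\mathcal{D}$, let $a_1<\cdots<a_{n-1}$ be real numbers, and let $E\in\mathcal{D}$ be an object with a finite descending filtration \[ E=E_n\to E_{n-1}\to\cdots\to E_1\to E_0=0 \] with associated graded objects $F_i:=\mathrm{fib}(E_i\to E_{i-1})$, $i=1,\dots,n$. Then \[ m^t(E)\le\sum_{i=1}^nm^t(F_i)\le m^t(E)+C_{n,\epsilon,t}\left(\sum_{j=1}^{n-1}\Big(m^t(F_{j+1}^{\le a_j})+m^t(F_j^{>a_j-\epsilon})\Big)\right). \]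
   Context: $k$ is a field. A pre-stability condition $\sigma=(Z,\mathcal{P})$ on $\mathcal{D}$ consists of a group homomorphism $Z:K_0(\mathcal{D})\to\mathbf{C}$ and a slicing, i.e. a collection $\mathcal{P}=\{\mathcal{P}(\phi)\}_{\phi\in\mathbf{R}}$ of full additive subcategories of $\mathcal{D}$, such that: (a) $\mathrm{Hom}(\mathcal{P}(\phi),\mathcal{P}(\psi))=0$ if $\phi>\psi$; (b) $\mathcal{P}(\phi)[1]=\mathcal{P}(\phi+1)$; (c) every non-zero object $E$ has a Harder--Narasimhan (HN) filtration $0=E_0\to E_1\to\cdots\to E_n=E$ whose successive cones $G_i$ (the HN factors, unique up to isomorphism) are non-zero objects of $\mathcal{P}(\phi_i)$ with $\phi_1>\cdots>\phi_n$; (d) $Z(E)\in\mathbf{R}_{>0}e^{i\pi\phi}$ for every non-zero $E\in\mathcal{P}(\phi)$. For $t\in\mathbf{R}$ the $t$-deformed mass of a non-zero $E$ with HN factors $G_i\in\mathcal{P}(\phi_i)$ is $m^t(E)=m^t_\sigma(E)=\sum_i|Z(G_i)|e^{t\phi_i}$, and $m^t(0)=0$. For $a\in\mathbf{R}$, $\mathcal{P}(>a)$ (resp. $\mathcal{P}(\le a)$) is the full subcategory of objects which are zero or all of whose HN factors have phase $>a$ (resp. $\le a$). These form a t-structure, and each object $E$ sits in a functorial exact triangle $E^{>a}\to E\to E^{\le a}$ with $E^{>a}\in\mathcal{P}(>a)$, $E^{\le a}\in\mathcal{P}(\le a)$. For a morphism $A\to B$, $\mathrm{fib}(A\to B)=\mathrm{Cone}(A\to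 B)[-1]$. *)

(* Defs.v *)
From HB Require Import structures.
From mathcomp Require Import all_boot all_order all_algebra.
From mathcomp Require Import all_classical all_reals all_analysis.
From mathcomp Require Import complex.
From mathcomp Require Import freeg.
Set Implicit Arguments.
Unset Strict Implicit.
Unset Printing Implicit Defensive.
Import Order.TTheory GRing.Theory Num.Theory.
Local Open Scope ring_scope.

Record linearCategory (k : fieldType) := LinearCategory {
  obj :> Type;
  mor : obj -> obj -> lmodType k;
  idm : forall X, mor X X;
  compm : forall X Y Z, mor Y Z -> mor X Y -> mor X Z;
  compm_idl : forall X Y (f : mor X Y), compm (idm Y) f = f;
  compm_idr : forall X Y (f : mor X Y), compm f (idm X) = f;
  compmA : forall W X Y Z (f : mor Y Z) (g : mor X Y) (h : mor W X),
    compm f (compm g h) = compm (compm f g) h;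
  compm_linearl : forall X Y Z (c : k) (f f' : mor Y Z) (g : mor X Y),
    compm (c *: f + f') g = c *: compm f g + compm f' g;
  compm_linearr : forall X Y Z (c : k) (f : mor Y Z) (g g' : mor X Y),
    compm f (c *: g + g') = c *: compm f g + compm f g' }.

Arguments mor {k l} X Y : rename.
Arguments idm {k l} X : rename.
Arguments compm {k l X Y Z} f g : rename.

Notation "g \oc f" := (compm g f) (at level 40, left associativity).

Section LinearCategoryNotions.
Variables (k : fieldType) (D : linearCategory k).
Implicit Types X Y Z S : D.

Definition is_zero X : Prop :=
  (forall Y (f : mor X Y), f = 0) /\ (forall Y (f : mor Y X), f = 0).

Definition is_iso X Y (f : mor X Y) : Prop :=
  exists g : mor Y X, g \oc f = idm X /\ f \oc g = idm Y.

Definition isomorphic X Y : Prop := exists f : mor X Y, is_iso f.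

Definition is_biproduct X Y S : Prop :=
  exists (i1 : mor X S) (i2 : mor Y S) (p1 : mor S X) (p2 : mor S Y),
    [/\ p1 \oc i1 = idm X, p2 \oc i2 = idm Y, p1 \oc i2 = 0, p2 \oc i1 = 0
      & i1 \oc p1 + i2 \oc p2 = idm S].

(* Full subcategories are identified with predicates on objects and are strict:
   [S] ranges over all direct sums, so (taking [Y] to be a zero object) such a
   predicate is closed under isomorphism. *)
Definition additive_subcategory (P : D -> Prop) : Prop :=
  (forall X, is_zero X -> P X) /\
  (forall X Y S, P X -> P Y -> is_biproduct X Y S -> P S).

End LinearCategoryNotions.

(* The shift is an autoequivalence: fully faithful, and essentially surjective
   with [unshift_obj X] a chosen representative of X[-1]. *)
Record triangulatedCategory (k : fieldType) := TriangulatedCategory {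
  underlying :> linearCategory k;
  zero_ex : exists X : underlying, is_zero X;
  biproduct_ex : forall X Y : underlying, exists S, is_biproduct X Y S;
  shift_obj : underlying -> underlying;
  shift_mor : forall X Y : underlying,
    mor X Y -> mor (shift_obj X) (shift_obj Y);
  shift_mor_id : forall X, shift_mor (idm X) = idm (shift_obj X);
  shift_mor_comp : forall X Y Z (g : mor Y Z) (f : mor X Y),
    shift_mor (g \oc f) = shift_mor g \oc shift_mor f;
  shift_mor_linear : forall X Y (c : k) (f f' : mor X Y),
    shift_mor (c *: f + f') = c *: shift_mor f + shift_mor f';
  shift_mor_bij : forall X Y, bijective (@shift_mor X Y);
  unshift_obj : underlying -> underlying;
  unshift_objK : forall X, isomorphic (shift_obj (unshift_obj X)) X;
  (* [exact_triangle f g h]: X -f-> Y -g-> Z -h-> X[1] is distinguished *)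
  exact_triangle : forall X Y Z : underlying,
    mor X Y -> mor Y Z -> mor Z (shift_obj X) -> Prop;
  (* TR1 *)
  exact_iso : forall X Y Z X' Y' Z' (f : mor X Y) (g : mor Y Z)
      (h : mor Z (shift_obj X)) (f' : mor X' Y') (g' : mor Y' Z')
      (h' : mor Z' (shift_obj X')) (u : mor X X') (v : mor Y Y') (w : mor Z Z'),
    is_iso u -> is_iso v -> is_iso w ->
    v \oc f = f' \oc u -> w \oc g = g' \oc v -> shift_mor u \oc h = h' \oc w ->
    exact_triangle f g h -> exact_triangle f' g' h';
  exact_id : forall X Z, is_zero Z ->
    exact_triangle (idm X) (0 : mor X Z) (0 : mor Z (shift_obj X));
  exact_complete : forall X Y (f : mor X Y),
    exists Z (g : mor Y Z) (h : mor Z (shift_obj X)), exact_triangle f g h;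
  (* TR2 *)
  exact_rot : forall X Y Z (f : mor X Y) (g : mor Y Z) (h : mor Z (shift_obj X)),
    exact_triangle f g h <-> exact_triangle g h (- shift_mor f);
  (* TR3 *)
  exact_mor : forall X Y Z X' Y' Z' (f : mor X Y) (g : mor Y Z)
      (h : mor Z (shift_obj X)) (f' : mor X' Y') (g' : mor Y' Z')
      (h' : mor Z' (shift_obj X')) (u : mor X X') (v : mor Y Y'),
    exact_triangle f g h -> exact_triangle f' g' h' -> v \oc f = f' \oc u ->
    exists w : mor Z Z', w \oc g = g' \oc v /\ shift_mor u \oc h = h' \oc w;
  (* TR4, the octahedral axiom *)
  exact_oct : forall X Y Z X' Y' Z' (f : mor X Y) (g : mor Y Z)
      (f1 : mor Y Z') (f2 : mor Z' (shift_obj X))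
      (g1 : mor Z X') (g2 : mor X' (shift_obj Y))
      (h1 : mor Z Y') (h2 : mor Y' (shift_obj X)),
    exact_triangle f f1 f2 -> exact_triangle g g1 g2 ->
    exact_triangle (g \oc f) h1 h2 ->
    exists (u : mor Z' Y') (v : mor Y' X'),
      [/\ exact_triangle u v (shift_mor f1 \oc g2),
          u \oc f1 = h1 \oc g, h2 \oc u = f2,
          v \oc h1 = g1 & g2 \oc v = shift_mor f \oc h2] }.

Arguments shift_obj {k t} X : rename.
Arguments unshift_obj {k t} X : rename.
Arguments shift_mor {k t X Y} f : rename.
Arguments exact_triangle {k t X Y Z} f g h : rename.
Arguments exact_id {k t X Z} : rename.

Section ConesAndK0.
Variables (k : fieldType) (D : triangulatedCategory k).

(* Cones are only defined up to isomorphism, hence relations. *)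
Definition is_cone (X Y : D) (f : mor X Y) (C : D) : Prop :=
  exists (g : mor Y C) (h : mor C (shift_obj X)), exact_triangle f g h.

Definition is_fib (X Y : D) (f : mor X Y) (F : D) : Prop :=
  exists C, is_cone f C /\ isomorphic F (unshift_obj C).

(* The subgroup of the free abelian group on the objects of D generated by
   [Y] - [X] - [Z] for all exact triangles X -> Y -> Z -> X[1]. *)
Definition triangle_relations : {pred {freeg {classic D}}} :=
  fun x => `[< forall S : zmodClosed {freeg {classic D}},
    (forall (X Y Z : D) (f : mor X Y) (g : mor Y Z) (h : mor Z (shift_obj X)),
       exact_triangle f g h ->
       << Y : {classic D} >> - << X : {classic D} >> - << Z : {classic D} >>
         \in S) ->
    x \in S >].

Fact triangle_relations_zmod_closed : zmod_closed triangle_relations.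
Proof.
split=> [|x y /asboolP hx /asboolP hy]; apply/asboolP => S hS.
  exact: rpred0.
by apply: rpredB; [exact: hx | exact: hy].
Qed.

HB.instance Definition _ :=
  GRing.isZmodClosed.Build {freeg {classic D}} triangle_relations
    triangle_relations_zmod_closed.

Definition K0 : zmodType := Quotient.quot triangle_relations.

Definition K0_class (X : D) : K0 :=
  (\pi_(Quotient.quot triangle_relations) << X : {classic D} >>)%qT.

Lemma K0_class_exact (X Y Z : D) (f : mor X Y) (g : mor Y Z)
    (h : mor Z (shift_obj X)) :
  exact_triangle f g h -> K0_class Y = K0_class X + K0_class Z.
Proof.
move=> exfgh; rewrite /K0_class -raddfD; apply/eqP.
rewrite -Quotient.idealrBE opprD addrA; apply/asboolP => S hS.
exact: hS exfgh.
Qed.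

End ConesAndK0.

Section Slicings.
Variables (R : realType) (k : fieldType) (D : triangulatedCategory k).

(* [is_HN P E s]: E has a Harder-Narasimhan filtration 0 = E_0 -> ... -> E_n = E
   and s = [:: (G_1, phi_1); ...; (G_n, phi_n)] lists the cones G_i of
   E_{i-1} -> E_i with their phases. *)
Inductive is_HN (P : R -> D -> Prop) : D -> seq (D * R) -> Prop :=
| HN_nil E : is_zero E -> is_HN P E [::]
| HN_rcons E' E (f : mor E' E) G phi s :
    is_HN P E' s -> is_cone f G -> ~ is_zero G -> P phi G ->
    all (fun x => phi < x.2) s ->
    is_HN P E (rcons s (G, phi)).

Record preStability := PreStability {
  central_charge : {additive K0 D -> R[i]};
  slice : R -> D -> Prop;
  slice_additive : forall phi, additive_subcategory (slice phi);
  slice_hom0 : forall phi psi (A B : D), psi < phi ->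
    slice phi A -> slice psi B -> forall f : mor A B, f = 0;
  slice_shift : forall phi (E : D),
    slice (phi + 1) E <->
    exists2 E', slice phi E' & isomorphic E (shift_obj E');
  slice_HN : forall E : D, ~ is_zero E -> exists s, is_HN slice E s;
  slice_charge : forall phi (E : D), slice phi E -> ~ is_zero E ->
    exists2 r : R, 0 < r &
      central_charge (K0_class E) =
        Complex (r * cos (pi * phi)) (r * sin (pi * phi)) }.

Variable sigma : preStability.

Definition HN_factors (E : D) : seq (D * R) :=
  match pselect (is_zero E) with
  | left _ => [::]
  | right nz => sval (cid (slice_HN sigma nz))
  end.

Definition mass (t : R) (E : D) : R :=
  \sum_(x <- HN_factors E)
    Normc.normc (central_charge sigma (K0_class x.1)) * expR (t * x.2).

(* HN factors being unique up to isomorphism, any filtration may be used. *)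
Definition slice_gt (a : R) (E : D) : Prop :=
  is_zero E \/ exists2 s, is_HN (slice sigma) E s & all (fun x => a < x.2) s.

Definition slice_le (a : R) (E : D) : Prop :=
  is_zero E \/ exists2 s, is_HN (slice sigma) E s & all (fun x => x.2 <= a) s.

Record truncation_triangle (a : R) (E : D) := TruncationTriangle {
  tau_gt : D;
  tau_le : D;
  tau_in : mor tau_gt E;
  tau_out : mor E tau_le;
  tau_conn : mor tau_le (shift_obj tau_gt);
  tau_exact : exact_triangle tau_in tau_out tau_conn;
  tau_gtP : slice_gt a tau_gt;
  tau_leP : slice_le a tau_le }.

Theorem truncation_triangle_ex (a : R) (E : D) :
  inhabited (truncation_triangle a E).
Proof.
have [Z0 Z0P] := zero_ex D.
suff [X [Y [i [p [h [s1 [s2 [exT HX HY [s1a s2a]]]]]]]]] :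
    exists X Y (i : mor X E) (p : mor E Y) (h : mor Y (shift_obj X)) s1 s2,
    [/\ exact_triangle i p h, is_HN (slice sigma) X s1,
        is_HN (slice sigma) Y s2
      & all (fun x => a < x.2) s1 /\ all (fun x => x.2 <= a) s2].
  by apply: (inhabits (TruncationTriangle exT _ _));
    right; [exists s1|exists s2].
have [E0|E0] := pselect (is_zero E).
  exists E, Z0, (idm E), 0, 0, [::], [::]; split=> //; last by constructor.
    exact: exact_id.
  exact: HN_nil.
have [s HNE] := slice_HN sigma E0.
suff [X [Y [i [p [h [s1 [s2 [exT HX HY [s1a s2a _]]]]]]]]] :
    exists X Y (i : mor X E) (p : mor E Y) (h : mor Y (shift_obj X)) s1 s2,
    [/\ exact_triangle i p h, is_HN (slice sigma) X s1,
        is_HN (slice sigma) Y s2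
      & [/\ all (fun x => a < x.2) s1, all (fun x => x.2 <= a) s2
          & s = s1 ++ s2]].
  by exists X, Y, i, p, h, s1, s2.
elim: {E E0} HNE => [E E0|E' E f G phi s' HE' IH fG G0 Gphi s'phi].
  exists E, Z0, (idm E), 0, 0, [::], [::]; split=> //.
  - exact: exact_id.
  - exact: HN_nil.
  - exact: HN_nil.
have [aphi|phia] := ltP a phi.
  exists E, Z0, (idm E), 0, 0, (rcons s' (G, phi)), [::]; split.
  - exact: exact_id.
  - exact: HN_rcons fG G0 Gphi s'phi.
  - exact: HN_nil.
  split=> //; last by rewrite cats0.
  rewrite all_rcons /= aphi /=.
  by apply: sub_all s'phi => x; exact: lt_trans.
case: IH => X [Y [i [p [h [s1 [s2 [exT HX HY [s1a s2a s'E]]]]]]]].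
have [Q [q [r exQ]]] := exact_complete (f \oc i).
have [g1 [g2 exf]] := fG.
have [u [v [exuv _ _ _ _]]] := exact_oct exT exf exQ.
exists X, Q, (f \oc i), q, r, s1, (rcons s2 (G, phi)); split=> //.
  apply: (HN_rcons (f := u) HY _ G0 Gphi _).
    by exists v, (shift_mor p \oc g2).
  by move: s'phi; rewrite s'E all_cat => /andP[].
split=> //; first by rewrite all_rcons /= phia.
by rewrite s'E rcons_cat.
Qed.

Definition truncation (a : R) (E : D) : truncation_triangle a E :=
  inhabited_witness (truncation_triangle_ex a E).

Definition trunc_gt (a : R) (E : D) : D := tau_gt (truncation a E).
Definition trunc_le (a : R) (E : D) : D := tau_le (truncation a E).

End Slicings.

(* Main.v *)
Require Import Defs.
From HB Require Import structures.
From mathcomp Require Import all_boot all_order all_algebra.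
From mathcomp Require Import all_classical all_reals all_analysis.
From mathcomp Require Import complex ring lra.
Set Implicit Arguments.
Unset Strict Implicit.
Unset Printing Implicit Defensive.
Import Order.TTheory GRing.Theory Num.Theory.
Import numFieldNormedType.Exports.
Local Open Scope ring_scope.

(* For real a let g_a(E) = Im (e^(-i pi a) Z(E^{>a})) and let
   N_a(E) = g_a(E) + g_{a+1}(E) >= 0, the imaginary part of e^(-i pi a) Z on
   the degree zero cohomology of E for the heart P((a, a+1]).  A semistable
   factor of charge norm r and phase phi contributes r sin(pi (phi - a)) to N_a
   for phi - 1 <= a <= phi and nothing otherwise; integrating against e^(t a)
   gives r e^(t phi) up to a positive constant depending only on t, so m^t is a
   positive multiple of the integral of e^(t a) N_a, and linear inequalities
   between the functions a |-> N_a yield inequalities between masses.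

   On an exact triangle A -> B -> C the function g_a is subadditive.  Its defect
   D_a = g_a(A) + g_a(C) - g_a(B) satisfies
   N_a(A) + N_a(C) = N_a(B) + D_a + D_{a+1}, and subadditivity for the rotated
   triangles reads D_a <= N_a(C) and D_a <= N_{a-1}(A).  For F_{j+1} -> E_{j+1}
   -> E_j the first bound is used for a > a_j, where only phases of the F_l,
   l <= j, above a_j count, and the second for a <= a_j, where only phases of
   F_{j+1} below a_j count. *)

(** * Exact triangles *)

Section LinearCategory.
Variables (k : fieldType) (D : linearCategory k).
Implicit Types X Y Z : D.

Lemma comp0m X Y Z (g : mor X Y) : (0 : mor Y Z) \oc g = 0.
Proof.
have := compm_linearl (-1) (0 : mor Y Z) 0 g.
by rewrite scaler0 addr0 scaleN1r addNr.
Qed.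

Lemma compm0 X Y Z (f : mor Y Z) : f \oc (0 : mor X Y) = 0.
Proof.
have := compm_linearr (-1) f (0 : mor X Y) 0.
by rewrite scaler0 addr0 scaleN1r addNr.
Qed.

Lemma compNm X Y Z (f : mor Y Z) (g : mor X Y) : (- f) \oc g = - (f \oc g).
Proof.
have := compm_linearl (-1) f 0 g.
by rewrite comp0m !addr0 !scaleN1r.
Qed.

Lemma compmN X Y Z (f : mor Y Z) (g : mor X Y) : f \oc (- g) = - (f \oc g).
Proof.
have := compm_linearr (-1) f g 0.
by rewrite compm0 !addr0 !scaleN1r.
Qed.

Lemma compmBr X Y Z (f : mor Y Z) (g g' : mor X Y) :
  f \oc (g - g') = f \oc g - f \oc g'.
Proof.
by have := compm_linearr (-1) f g' g; rewrite !scaleN1r ![- _ + _]addrC.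
Qed.

Lemma is_zero_idm X : idm X = 0 -> is_zero X.
Proof.
move=> idX; split=> Y f; first by rewrite -[f]compm_idr idX compm0.
by rewrite -[f]compm_idl idX comp0m.
Qed.

Lemma is_iso_idm X : is_iso (idm X).
Proof. by exists (idm X); rewrite compm_idl. Qed.

Lemma isomorphic_refl X : isomorphic X X.
Proof. by exists (idm X); exact: is_iso_idm. Qed.

Lemma isomorphic_sym X Y : isomorphic X Y -> isomorphic Y X.
Proof. by move=> [f [g [gf fg]]]; exists g, f. Qed.

Lemma is_iso_comp X Y Z (g : mor Y Z) (f : mor X Y) :
  is_iso g -> is_iso f -> is_iso (g \oc f).
Proof.
move=> [g' [g'g gg']] [f' [f'f ff']]; exists (f' \oc g'); split.
  by rewrite -compmA (compmA g') g'g compm_idl.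
by rewrite -compmA (compmA f) ff' compm_idl.
Qed.

Lemma isomorphic_trans X Y Z :
  isomorphic X Y -> isomorphic Y Z -> isomorphic X Z.
Proof. by move=> [f fi] [g gi]; exists (g \oc f); exact: is_iso_comp. Qed.

Lemma is_zero_isomorphic X Y : isomorphic X Y -> is_zero X -> is_zero Y.
Proof.
move=> [f [g [gf fg]]] [X0 _]; apply: is_zero_idm.
by rewrite -fg (X0 _ f) comp0m.
Qed.

Lemma is_iso_lrinv X Y (f : mor X Y) (g g' : mor Y X) :
  g \oc f = idm X -> f \oc g' = idm Y -> is_iso f.
Proof.
move=> gf fg'; exists g; split=> //.
by rewrite -[g]compm_idr -fg' (compmA g) gf compm_idl.
Qed.

End LinearCategory.

Section Triangulated.
Variables (k : fieldType) (D : triangulatedCategory k).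
Implicit Types X Y Z W A B C : D.

Lemma shift_mor0 X Y : shift_mor (0 : mor X Y) = 0.
Proof.
have := shift_mor_linear (-1) (0 : mor X Y) 0.
by rewrite scaler0 addr0 scaleN1r addNr.
Qed.

Lemma shift_morN X Y (f : mor X Y) : shift_mor (- f) = - shift_mor f.
Proof.
have := shift_mor_linear (-1) f 0.
by rewrite shift_mor0 !addr0 !scaleN1r.
Qed.

Lemma shift_mor_inj X Y : injective (@shift_mor k D X Y).
Proof. exact: bij_inj (shift_mor_bij X Y). Qed.

Lemma shift_mor_full X Y (f : mor (shift_obj X) (shift_obj Y)) :
  exists g : mor X Y, f = shift_mor g.
Proof. by have [g _ fg] := shift_mor_bij X Y; exists (g f); rewrite fg. Qed.

Lemma is_iso_shift X Y (f : mor X Y) : is_iso f -> is_iso (shift_mor f).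
Proof.
move=> [g [gf fg]]; exists (shift_mor g).
by rewrite -!shift_mor_comp gf fg !shift_mor_id.
Qed.

Lemma isomorphic_shift X Y :
  isomorphic X Y -> isomorphic (shift_obj X) (shift_obj Y).
Proof. by move=> [f fi]; exists (shift_mor f); exact: is_iso_shift. Qed.

Lemma is_zero_shift X : is_zero X -> is_zero (shift_obj X).
Proof.
move=> [X0 _]; apply: is_zero_idm.
by rewrite -shift_mor_id (X0 _ (idm X)) shift_mor0.
Qed.

Lemma is_zero_unshift X : is_zero (shift_obj X) -> is_zero X.
Proof.
move=> [X0 _]; apply: is_zero_idm; apply: shift_mor_inj.
by rewrite shift_mor0 shift_mor_id (X0 _ (idm _)).
Qed.

Lemma exact_of_iso X Y Z (f : mor X Y) : is_iso f -> is_zero Z ->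
  exact_triangle f (0 : mor Y Z) (0 : mor Z (shift_obj X)).
Proof.
move=> fi Z0.
apply: (exact_iso (is_iso_idm X) fi (is_iso_idm Z) _ _ _ (exact_id Z0)).
- by [].
- by rewrite compm0 comp0m.
- by rewrite compm0 comp0m.
Qed.

Lemma exact_idr X Y : is_zero X ->
  exact_triangle (0 : mor X Y) (idm Y) (0 : mor Y (shift_obj X)).
Proof.
move=> X0; apply/exact_rot; rewrite shift_mor0 oppr0.
exact: exact_id (is_zero_shift X0).
Qed.

Lemma exact_shift0 X Y : is_zero Y ->
  exact_triangle (0 : mor X Y) (0 : mor Y (shift_obj X)) (- idm (shift_obj X)).
Proof.
move=> Y0; rewrite -shift_mor_id; apply: (proj1 (exact_rot _ _ _)).
exact: exact_id.
Qed.

(** * Factorisation through the terms of an exact triangle *)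

Section OneTriangle.
Variables (X Y Z : D) (f : mor X Y) (g : mor Y Z) (h : mor Z (shift_obj X)).
Hypothesis fgh : exact_triangle f g h.

(** TR3 is applied to a map from f, g, h to the triangle 0 -> W -> W; the third component it
    supplies is the factor. *)
Lemma exact_factor_out W (u : mor Y W) :
  u \oc f = 0 -> exists v : mor Z W, u = v \oc g.
Proof.
move=> uf; have [N N0] := zero_ex D.
have e : u \oc f = (0 : mor N W) \oc (0 : mor X N) by rewrite uf compm0.
have [v [vg _]] := exact_mor fgh (exact_idr W N0) e.
by exists v; rewrite vg compm_idl.
Qed.

(** TR3 is applied to a map from W -> 0 -> W[1] to the rotated triangle. The third component is a
    map W[1] -> X[1], which descends to W -> X because the shift is fully faithful; the two rotation
    signs cancel. *)
Lemma exact_factor_in W (u : mor W Y) :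
  g \oc u = 0 -> exists v : mor W X, u = f \oc v.
Proof.
move=> gu; have [N N0] := zero_ex D.
have e : (0 : mor N Z) \oc (0 : mor W N) = g \oc u by rewrite gu compm0.
have [w [_]] := exact_mor (exact_shift0 W N0) (proj1 (exact_rot f g h) fgh) e.
have [v ->] := shift_mor_full w.
rewrite compmN compm_idr compNm -shift_mor_comp => /oppr_inj/shift_mor_inj uE.
by exists v.
Qed.

(** Since g = 0, the identity of Y lifts through f, giving a right inverse. Since h = 0, TR3 on the
    twice rotated triangle gives a left inverse of -f[1], hence the sign in [- w']. *)
Lemma exact_third_zero_iso : is_zero Z -> is_iso f.
Proof.
move=> [Z0 Z0']; have [v fv] : exists v, idm Y = f \oc v.
  by apply: exact_factor_in; rewrite (Z0' _ g) comp0m.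
have exh := proj1 (exact_rot _ _ _) (proj1 (exact_rot _ _ _) fgh).
have [N N0] := zero_ex D.
have e : idm (shift_obj X) \oc h = (0 : mor N _) \oc (0 : mor Z N).
  by rewrite (Z0 _ h) !compm0.
have [w [wf _]] := exact_mor exh (exact_idr _ N0) e.
have [w' wE] := shift_mor_full w.
apply: (@is_iso_lrinv _ _ _ _ _ (- w') v) => //.
apply: shift_mor_inj; rewrite shift_mor_comp shift_mor_id shift_morN -wE.
by rewrite compNm -compmN wf compm_idl.
Qed.

End OneTriangle.

Lemma exact_rotate X Y Z (f : mor X Y) (g : mor Y Z)
    (h : mor Z (shift_obj X)) :
  exact_triangle f g h -> exact_triangle g h (- shift_mor f).
Proof. by move=> /exact_rot. Qed.

(** The composite is a separate map [e] with an equation, so that two factorisations of one map can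
    share the same cone. *)
Lemma exact_octahedron X Y Z Z' X' Y' (f : mor X Y) (g : mor Y Z) (e : mor X Z)
    (f1 : mor Y Z') (f2 : mor Z' (shift_obj X))
    (g1 : mor Z X') (g2 : mor X' (shift_obj Y))
    (e1 : mor Z Y') (e2 : mor Y' (shift_obj X)) :
  e = g \oc f -> exact_triangle f f1 f2 -> exact_triangle g g1 g2 ->
  exact_triangle e e1 e2 ->
  exists (u : mor Z' Y') (v : mor Y' X') (w : mor X' (shift_obj Z')),
    exact_triangle u v w.
Proof.
move=> -> exf exg exe; have [u [v [exuv _ _ _ _]]] := exact_oct exf exg exe.
by exists u, v, (shift_mor f1 \oc g2).
Qed.

Lemma K0_class_zero X : is_zero X -> K0_class X = 0 :> K0 D.
Proof.
move=> X0; have := K0_class_exact (exact_id X0 (X := X)).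
by move=> /eqP; rewrite -subr_eq0 opprD addNKr oppr_eq0 => /eqP.
Qed.

Lemma K0_class_iso X Y : isomorphic X Y -> K0_class X = K0_class Y.
Proof.
have [N N0] := zero_ex D.
move=> [f fi]; have := K0_class_exact (exact_of_iso fi N0).
by rewrite (K0_class_zero N0) addr0.
Qed.

Lemma K0_class_shift X : K0_class (shift_obj X) = - K0_class X.
Proof.
have [N N0] := zero_ex D.
have := K0_class_exact (exact_shift0 X N0).
by rewrite (K0_class_zero N0) => /esym/eqP; rewrite addrC addr_eq0 => /eqP.
Qed.

End Triangulated.

(** * Truncations of a slicing *)

Section Slicing.
Variables (R : realType) (k : fieldType) (D : triangulatedCategory k).
Variable sigma : preStability R D.
Implicit Types (X Y Z W A B C E G : D) (s : seq (D * R)) (a b : R).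

Let HN := is_HN (slice sigma).

Lemma HN_iso X Y s : isomorphic X Y -> HN X s -> HN Y s.
Proof.
move=> XY HX; case: HX XY => [E E0|E' E f G phi s' HE' [g [h ex]] G0 Gphi s'phi].
  by move=> EY; exact/HN_nil/(is_zero_isomorphic EY).
move=> [v vi]; apply: (HN_rcons (f := v \oc f) HE' _ G0 Gphi s'phi).
have [v' [v'v vv']] := vi.
exists (g \oc v'), h.
apply: (exact_iso (is_iso_idm E') vi (is_iso_idm G) _ _ _ ex).
- by rewrite compm_idr.
- by rewrite compm_idl -compmA v'v compm_idr.
- by rewrite shift_mor_id compm_idl compm_idr.
Qed.

(** Rotating three times shifts all three maps and negates each of them, so the shifted filtration
    uses -f[1]. *)
Lemma HN_shift X s : HN X s ->
  HN (shift_obj X) [seq (shift_obj x.1, x.2 + 1) | x <- s].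
Proof.
elim=> [E E0|E' E f G phi s' _ IH [g [h ex]] G0 Gphi s'phi].
  exact/HN_nil/is_zero_shift.
rewrite map_rcons; apply: (HN_rcons (f := - shift_mor f) IH).
- exists (- shift_mor g), (- shift_mor h).
  exact/exact_rotate/exact_rotate/exact_rotate.
- by move=> /is_zero_unshift.
- by apply/slice_shift; exists G => //; exact: isomorphic_refl.
- by rewrite all_map; apply: sub_all s'phi => x /=; rewrite ltrD2r.
Qed.

Lemma HN_factorsP E : HN E (HN_factors sigma E).
Proof.
rewrite /HN_factors; case: pselect => [E0|E0]; first exact: HN_nil.
exact: svalP (cid (slice_HN sigma E0)).
Qed.

Lemma slice_gtP a X :
  slice_gt sigma a X <-> exists2 s, HN X s & all (fun x => a < x.2) s.
Proof.
split=> [[X0|//]|]; last by right.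
by exists [::] => //; exact: HN_nil.
Qed.

Lemma slice_leP a X :
  slice_le sigma a X <-> exists2 s, HN X s & all (fun x => x.2 <= a) s.
Proof.
split=> [[X0|//]|]; last by right.
by exists [::] => //; exact: HN_nil.
Qed.

Lemma slice_gt_iso a X Y :
  isomorphic X Y -> slice_gt sigma a X -> slice_gt sigma a Y.
Proof.
move=> XY /slice_gtP[s Hs sa]; apply/slice_gtP; exists s => //.
exact: HN_iso Hs.
Qed.

Lemma slice_le_iso a X Y :
  isomorphic X Y -> slice_le sigma a X -> slice_le sigma a Y.
Proof.
move=> XY /slice_leP[s Hs sa]; apply/slice_leP; exists s => //.
exact: HN_iso Hs.
Qed.

Lemma slice_gt_shift a X :
  slice_gt sigma a X -> slice_gt sigma (a + 1) (shift_obj X).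
Proof.
move=> /slice_gtP[s /HN_shift Hs sa]; apply/slice_gtP; eexists; first exact: Hs.
by rewrite all_map; apply: sub_all sa => x /=; rewrite ltrD2r.
Qed.

Lemma slice_le_shift a X :
  slice_le sigma a X -> slice_le sigma (a + 1) (shift_obj X).
Proof.
move=> /slice_leP[s /HN_shift Hs sa]; apply/slice_leP; eexists; first exact: Hs.
by rewrite all_map; apply: sub_all sa => x /=; rewrite lerD2r.
Qed.

Lemma slice_gt_weaken a b X :
  b <= a -> slice_gt sigma a X -> slice_gt sigma b X.
Proof.
move=> ba /slice_gtP[s Hs sa]; apply/slice_gtP; exists s => //.
by apply: sub_all sa => x; exact: le_lt_trans.
Qed.

Lemma slice_le_weaken a b X :
  a <= b -> slice_le sigma a X -> slice_le sigma b X.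
Proof.
move=> ab /slice_leP[s Hs sa]; apply/slice_leP; exists s => //.
by apply: sub_all sa => x /= xa; exact: le_trans xa ab.
Qed.

(** * Orthogonality and the t-structure of a slicing *)

Lemma slice_hom_le0 a phi A Y (f : mor A Y) :
  a < phi -> slice sigma phi A -> slice_le sigma a Y -> f = 0.
Proof.
move=> aphi sA /slice_leP[s Hs]; elim: Hs f => {Y s}
  [Y Y0|Y' Y i G psi s _ IH [g [h ex]] G0 Gpsi _] f.
  by move=> _; apply: (proj2 Y0).
rewrite all_rcons => /andP[psia sa].
have [v ->] : exists v, f = i \oc v.
  apply: (exact_factor_in ex).
  exact: slice_hom0 (le_lt_trans psia aphi) sA Gpsi _.
by rewrite (IH v sa) compm0.
Qed.

(** Induction along the HN filtration of X: f vanishes on the previous step, so it factors through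
    the last semistable factor, where [slice_hom_le0] applies. *)
Lemma hom_gt_le0 a X Y (f : mor X Y) :
  slice_gt sigma a X -> slice_le sigma a Y -> f = 0.
Proof.
move=> /slice_gtP[s Hs sa] leY; elim: Hs f sa => {X s}
  [X X0|X' X i G psi s _ IH [g [h ex]] G0 Gpsi _] f.
  by move=> _; apply: (proj1 X0).
rewrite all_rcons => /andP[psia sa].
have [v ->] : exists v, f = v \oc g.
  by apply: (exact_factor_out ex); exact: IH.
by rewrite (slice_hom_le0 v psia Gpsi leY) comp0m.
Qed.

Lemma truncation_map_lift a W X B Y (i : mor X B) (p : mor B Y) h :
  exact_triangle i p h -> slice_gt sigma a W -> slice_le sigma a Y ->
  forall f : mor W B, exists g, f = i \oc g.
Proof.
by move=> ex gtW leY f; apply: (exact_factor_in ex); exact: hom_gt_le0 gtW leY.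
Qed.

(** The shift of f factors through h by a map W[1] -> Y, which is zero because W[1] lies in P(> a +
    1) and Y in P(<= a). *)
Lemma truncation_mono a W X B Y (i : mor X B) (p : mor B Y) h (f : mor W X) :
  exact_triangle i p h -> slice_gt sigma a W -> slice_le sigma a Y ->
  i \oc f = 0 -> f = 0.
Proof.
move=> ex gtW leY if0; apply: shift_mor_inj; rewrite shift_mor0.
have [v ->] : exists v, shift_mor f = h \oc v.
  apply: (exact_factor_in (exact_rotate (exact_rotate ex))).
  by rewrite compNm -shift_mor_comp if0 shift_mor0 oppr0.
rewrite (hom_gt_le0 v (slice_gt_shift gtW)) ?compm0 //.
by apply: slice_le_weaken leY; rewrite lerDl.
Qed.

(** Each of i and i' lifts through the other; [truncation_mono] forces the lifts to be mutually
    inverse. *)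
Lemma truncation_unique a X B Y (i : mor X B) (p : mor B Y) h
    X' Y' (i' : mor X' B) (p' : mor B Y') h' :
  exact_triangle i p h -> exact_triangle i' p' h' ->
  slice_gt sigma a X -> slice_le sigma a Y ->
  slice_gt sigma a X' -> slice_le sigma a Y' -> isomorphic X X'.
Proof.
move=> ex ex' gtX leY gtX' leY'.
have [u iE] := truncation_map_lift ex' gtX leY' i.
have [u' i'E] := truncation_map_lift ex gtX' leY i'.
exists u, u'; split; apply/eqP; rewrite -subr_eq0; apply/eqP.
  apply: (truncation_mono ex gtX leY).
  by rewrite compmBr compm_idr compmA -i'E -iE subrr.
apply: (truncation_mono ex' gtX' leY').
by rewrite compmBr compm_idr compmA -iE -i'E subrr.
Qed.

(** In the truncation triangle T -> X -> U the second map is zero, so the identity of U factors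
    through T[1] -> U. That map is zero as well, hence U = 0 and T is isomorphic to X. *)
Lemma slice_gt_orthogonal a X :
  (forall Y (f : mor X Y), slice_le sigma a Y -> f = 0) -> slice_gt sigma a X.
Proof.
move=> orth; have [[T U i p h ex gtT leU]] := truncation_triangle_ex sigma a X.
apply: (slice_gt_iso _ gtT); exists i; apply: (exact_third_zero_iso ex).
have p0 := orth _ p leU.
have [v vE] := exact_factor_out (exact_rotate ex)
  (u := idm U) (etrans (compm_idl p) p0).
apply: is_zero_idm; rewrite vE (hom_gt_le0 v (slice_gt_shift gtT)) ?comp0m //.
by apply: slice_le_weaken leU; rewrite lerDl.
Qed.

Lemma slice_le_orthogonal a Y :
  (forall X (f : mor X Y), slice_gt sigma a X -> f = 0) -> slice_le sigma a Y.
Proof.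
move=> orth; have [[T U i p h ex gtT leU]] := truncation_triangle_ex sigma a Y.
apply: (slice_le_iso _ leU); apply: isomorphic_sym; exists p.
apply: (exact_third_zero_iso (exact_rotate ex)); apply: is_zero_shift.
apply: is_zero_idm; apply: (truncation_mono ex gtT leU).
by rewrite (orth _ i gtT) comp0m.
Qed.

Lemma slice_gt_ext a X Y Z (f : mor X Y) (g : mor Y Z) h :
  exact_triangle f g h -> slice_gt sigma a X -> slice_gt sigma a Z ->
  slice_gt sigma a Y.
Proof.
move=> ex gtX gtZ; apply: slice_gt_orthogonal => W u leW.
have [v ->] := exact_factor_out ex (hom_gt_le0 (u \oc f) gtX leW).
by rewrite (hom_gt_le0 v gtZ leW) comp0m.
Qed.

Lemma slice_le_ext a X Y Z (f : mor X Y) (g : mor Y Z) h :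
  exact_triangle f g h -> slice_le sigma a X -> slice_le sigma a Z ->
  slice_le sigma a Y.
Proof.
move=> ex leX leZ; apply: slice_le_orthogonal => W u gtW.
have [v ->] := exact_factor_in ex (hom_gt_le0 (g \oc u) gtW leZ).
by rewrite (hom_gt_le0 v gtW leX) compm0.
Qed.

Lemma slice_le_fiber a X Y Z (f : mor X Y) (g : mor Y Z) h :
  exact_triangle f g h -> slice_le sigma a Y -> slice_le sigma a Z ->
  slice_le sigma a X.
Proof.
move=> ex leY leZ; apply: slice_le_orthogonal => W u gtW.
by apply: (truncation_mono ex gtW leZ); exact: hom_gt_le0 gtW leY.
Qed.

Lemma slice_gt_cone a X Y Z (f : mor X Y) (g : mor Y Z) h :
  exact_triangle f g h -> slice_gt sigma a X -> slice_gt sigma a Y ->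
  slice_gt sigma a Z.
Proof.
move=> ex gtX gtY; apply: slice_gt_ext (exact_rotate ex) gtY _.
by apply: slice_gt_weaken (slice_gt_shift gtX); rewrite lerDl.
Qed.

(** Cuts the HN filtration at phase a while keeping track of the factors. When the last phase is at
    most a, the octahedron on X -> E' -> E adjoins G to the quotient. *)
Lemma HN_split a E s : HN E s ->
  exists X Y (i : mor X E) (p : mor E Y) h,
    [/\ exact_triangle i p h, HN X [seq x <- s | a < x.2]
      & HN Y [seq x <- s | x.2 <= a]].
Proof.
have [N N0] := zero_ex D.
elim=> {E s} [E E0|E' E f G phi s HE' IH fG G0 Gphi sphi].
  exists E, N, (idm E), 0, 0.
  by split; [exact: exact_id|exact: HN_nil|exact: HN_nil].
have HE := HN_rcons HE' fG G0 Gphi sphi.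
rewrite !filter_rcons /=; case: ltP => aphi.
  have sa : all (fun x => a < x.2) s.
    by apply: sub_all sphi => x; exact: lt_trans.
  exists E, N, (idm E), 0, 0; split; first exact: exact_id.
    by move: sa => /all_filterP ->.
  suff -> : [seq x <- s | x.2 <= a] = [::] by exact: HN_nil.
  rewrite -(filter_pred0 s).
  elim: s sa {HE' IH HE sphi} => //= x s IH /andP[ax /IH].
  by rewrite leNgt ax.
have [X [Y [i [p [h [exT HX HY]]]]]] := IH.
have [g1 [g2 exf]] := fG.
have [Q [q [r exQ]]] := exact_complete (f \oc i).
have [u [v [w exuv]]] := exact_octahedron erefl exT exf exQ.
exists X, Q, (f \oc i), q, r; split=> //.
apply: (HN_rcons (f := u) HY _ G0 Gphi); first by exists v, w.
by rewrite all_filter; apply: sub_all sphi => x /= ->; rewrite implybT.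
Qed.

End Slicing.

(** * Subadditivity of the truncated charge *)

Section Charge.
Variables (R : realType) (k : fieldType) (D : triangulatedCategory k).
Variable sigma : preStability R D.
Implicit Types (X Y Z W A B C E G : D) (s : seq (D * R)) (a b : R).

Let HN := is_HN (slice sigma).

Definition charge_norm E : R :=
  Normc.normc (central_charge sigma (K0_class E)).

(* The imaginary part of e^(-i pi a) Z(E). *)
Definition charge_height a E : R :=
  complex.Im (central_charge sigma (K0_class E)) * cos (pi * a) -
  complex.Re (central_charge sigma (K0_class E)) * sin (pi * a).

(* This is g_a of the header, see [top_height_truncation]. *)
Definition top_height a E : R :=
  \sum_(x <- HN_factors sigma E | a < x.2) charge_norm x.1 * sin (pi * (x.2 - a)).

(* This is N_a of the header. *)
Definition heart_height a E : R := top_height a E + top_height (a + 1) E.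

Lemma charge_norm_ge0 E : 0 <= charge_norm E.
Proof.
rewrite /charge_norm /Normc.normc; case: (central_charge _ _) => x y /=.
exact: sqrtr_ge0.
Qed.

Lemma charge_height_exact a X Y Z (f : mor X Y) (g : mor Y Z) h :
  exact_triangle f g h ->
  charge_height a Y = charge_height a X + charge_height a Z.
Proof.
move=> ex; rewrite /charge_height (K0_class_exact ex) raddfD.
case: (central_charge _ _) => x1 y1; case: (central_charge _ _) => x2 y2 /=; ring.
Qed.

Lemma charge_height_zero a X : is_zero X -> charge_height a X = 0.
Proof.
by move=> X0; rewrite /charge_height K0_class_zero // raddf0 !mul0r subrr.
Qed.

Lemma charge_height_iso a X Y :
  isomorphic X Y -> charge_height a X = charge_height a Y.
Proof. by move=> XY; rewrite /charge_height (K0_class_iso XY). Qed.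

Lemma charge_height_shift a X :
  charge_height (a + 1) (shift_obj X) = charge_height a X.
Proof.
rewrite /charge_height K0_class_shift raddfN mulrDr mulr1 cosDpi sinDpi.
case: (central_charge _ _) => x y /=; ring.
Qed.

Lemma charge_heightD1 a X : charge_height (a + 1) X = - charge_height a X.
Proof. rewrite /charge_height mulrDr mulr1 cosDpi sinDpi; ring. Qed.

Lemma charge_height_slice a phi G : slice sigma phi G -> ~ is_zero G ->
  charge_height a G = charge_norm G * sin (pi * (phi - a)).
Proof.
move=> sG G0; rewrite /charge_height /charge_norm.
have [r r0 ->] := slice_charge sG G0.
rewrite /Normc.normc /= !exprMn -mulrDr cos2Dsin2 mulr1 sqrtr_sqr gtr0_norm //.
rewrite mulrBr sinB; ring.
Qed.

Lemma HN_charge_height a E s : HN E s ->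
  charge_height a E = \sum_(x <- s) charge_norm x.1 * sin (pi * (x.2 - a)).
Proof.
elim=> {E s} [E E0|E' E f G phi s _ IH [g [h ex]] G0 Gphi _].
  by rewrite big_nil charge_height_zero.
rewrite big_rcons /= -IH (charge_height_exact a ex).
by rewrite (charge_height_slice a Gphi G0) addrC.
Qed.

(** [HN_split] realises the sum as the charge height of one truncation, and truncations are unique
    up to isomorphism. So the value depends neither on the chosen HN factors nor on the chosen
    triangle. *)
Lemma top_height_truncation a X B Y (i : mor X B) (p : mor B Y) h :
  exact_triangle i p h -> slice_gt sigma a X -> slice_le sigma a Y ->
  top_height a B = charge_height a X.
Proof.
move=> ex gtX leY.
have [X' [Y' [i' [p' [h' [ex' HX' HY']]]]]] := HN_split a (HN_factorsP sigma B).
rewrite /top_height -big_filter -(HN_charge_height a HX').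
apply: charge_height_iso; apply: (truncation_unique ex' ex _ _ gtX leY).
  by apply/slice_gtP; eexists; [exact: HX'|exact: filter_all].
by apply/slice_leP; eexists; [exact: HY'|exact: filter_all].
Qed.

Lemma top_height_gt a X :
  slice_gt sigma a X -> top_height a X = charge_height a X.
Proof.
have [N N0] := zero_ex D.
move=> gtX; apply: (top_height_truncation (exact_id N0 (X := X)) gtX).
by left.
Qed.

Lemma top_height_le a Y : slice_le sigma a Y -> top_height a Y = 0.
Proof.
have [N N0] := zero_ex D.
move=> leY; rewrite -(charge_height_zero a N0).
by apply: (top_height_truncation (exact_idr Y N0) _ leY); left.
Qed.

(** The shift negates the class in K0 and moving a to a + 1 negates the charge height; three
    rotations turn a truncation triangle of X at a into one of X[1] at a + 1. *)
Lemma top_height_shift a X : top_height (a + 1) (shift_obj X) = top_height a X.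
Proof.
have [[T U i p h ex gtT leU]] := truncation_triangle_ex sigma a X.
rewrite (top_height_truncation ex gtT leU) -charge_height_shift.
apply: (top_height_truncation (exact_rotate (exact_rotate (exact_rotate ex)))).
  exact: slice_gt_shift.
exact: slice_le_shift.
Qed.

(** Contribution to N_a of a semistable factor of unit charge norm and phase a + s. For s > 1 the
    two terms cancel, leaving one arch of the sine on [0, 1]. *)
Definition sine_arch (s : R) : R :=
  (if 0 < s then sin (pi * s) else 0) + (if 1 < s then sin (pi * (s - 1)) else 0).

Lemma heart_heightE a E :
  heart_height a E =
  \sum_(x <- HN_factors sigma E) charge_norm x.1 * sine_arch (x.2 - a).
Proof.
rewrite /heart_height /top_height big_mkcond [X in _ + X]big_mkcond -big_split.
apply: eq_bigr => x _; rewrite /sine_arch subr_gt0 ltrBrDl.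
rewrite opprD addrA [RHS]mulrDr.
by case: ifP => _; case: ifP => _; rewrite ?mulr0.
Qed.

Lemma sine_archE (s : R) : sine_arch s = if 0 <= s <= 1 then sin (pi * s) else 0.
Proof.
rewrite /sine_arch; case: (ltgtP s 0) => [s0|s0|->] /=.
- by rewrite ltNge (le_trans (ltW s0)) ?ler01 // addr0.
- case: (ltP 1 s) => s1; last by rewrite addr0.
  by rewrite mulrBr mulr1 sinB cospi sinpi mulr0 subr0 mulrN1 subrr.
- by rewrite ltr10 ler01 mulr0 sin0 addr0.
Qed.

Lemma sine_arch_ge0 (s : R) : 0 <= sine_arch s.
Proof.
rewrite sine_archE; case: ifP => // /andP[s0 s1].
have pi0 := pi_ge0 R.
by apply: sin_ge0_pi; rewrite mulr_ge0 //= ler_piMr.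
Qed.

Lemma heart_height_ge0 a E : 0 <= heart_height a E.
Proof.
rewrite heart_heightE; apply: sumr_ge0 => x _.
by rewrite mulr_ge0 ?charge_norm_ge0 ?sine_arch_ge0.
Qed.

Lemma charge_height_ge0 a V :
  slice_gt sigma a V -> slice_le sigma (a + 1) V -> 0 <= charge_height a V.
Proof.
move=> gtV leV; rewrite -top_height_gt //.
by have := heart_height_ge0 a V; rewrite /heart_height (top_height_le leV) addr0.
Qed.

(* The cone of B^{>a} -> C^{>a} lies in P(> a) and in P(<= a + 1), so its charge
   height is nonnegative. *)
Lemma top_height_sub_le a A B C (f : mor A B) (g : mor B C) h :
  exact_triangle f g h -> slice_le sigma a A -> top_height a B <= top_height a C.
Proof.
move=> ex leA.
have [[Bt Bl i p c exB gtB leB]] := truncation_triangle_ex sigma a B.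
have [[Ct Cl j q d exC gtC leC]] := truncation_triangle_ex sigma a C.
rewrite (top_height_truncation exB gtB leB) (top_height_truncation exC gtC leC).
have [m mE] := truncation_map_lift exC gtB leC (g \oc i).
(* V, the cone of B^{>a} -> C, is an extension of A[1] by B^{<=a}, hence lies in P(<= a + 1). The
   cone V' of the lift m is the fibre of a map V -> C^{<=a}, so it inherits this bound. *)
have [V [v1 [v2 exV]]] := exact_complete (g \oc i).
have [u1 [u2 [u3 exu]]] := exact_octahedron erefl exB (exact_rotate ex) exV.
have leV : slice_le sigma (a + 1) V.
  apply: (slice_le_ext exu); last exact: slice_le_shift.
  by apply: slice_le_weaken leB; rewrite lerDl.
have [V' [m1 [m2 exm]]] := exact_complete m.
have [t1 [t2 [t3 ext]]] := exact_octahedron mE exm exC exV.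
have leV' : slice_le sigma (a + 1) V'.
  apply: (slice_le_fiber ext leV).
  by apply: slice_le_weaken leC; rewrite lerDl.
rewrite (charge_height_exact a exm) lerDl charge_height_ge0 //.
exact: slice_gt_cone exm gtB gtC.
Qed.

(** Let B1 be the cone of A^{>a} -> B and Q the cone of its lift A^{>a} -> B^{>a}. Then Q is the
    truncation of B1, so the heights of A and B1 add up to that of B. The triangle A^{<=a} -> B1 ->
    C reduces the claim to [top_height_sub_le]. *)
Lemma top_height_subadditive a A B C (f : mor A B) (g : mor B C) h :
  exact_triangle f g h -> top_height a B <= top_height a A + top_height a C.
Proof.
move=> ex.
have [[At Al i p c exA gtA leA]] := truncation_triangle_ex sigma a A.
have [[Bt Bl j q d exB gtB leB]] := truncation_triangle_ex sigma a B.
have [m mE] := truncation_map_lift exB gtA leB (f \oc i).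
have [B1 [b1 [b2 ex1]]] := exact_complete (f \oc i).
have [u1 [u2 [u3 exu]]] := exact_octahedron erefl exA ex ex1.
have [Q [m1 [m2 exm]]] := exact_complete m.
have [t1 [t2 [t3 ext]]] := exact_octahedron mE exm exB ex1.
have gtQ := slice_gt_cone exm gtA gtB.
rewrite (top_height_truncation exA gtA leA) (top_height_truncation exB gtB leB).
rewrite (charge_height_exact a exm) lerD2l.
rewrite -(top_height_truncation ext gtQ leB).
exact: top_height_sub_le exu leA.
Qed.

End Charge.

(** * From sine arches to exponential weights *)

Section ArchTransform.
Variable R : realType.
Implicit Types (a b c d t v w phi : R) (f g : R -> R) (s : seq (R * R)).

Definition arch_sum s a : R := \sum_(x <- s) x.1 * sine_arch (x.2 - a).

Definition exp_sum t s : R := \sum_(x <- s) x.1 * expR (t * x.2).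

(** The factor t^2 + pi^2 is the one produced by integrating by parts twice; it keeps the
    antiderivative free of denominators. *)
Definition exp_arch t phi a : R :=
  (t ^+ 2 + pi ^+ 2) * (expR (t * a) * sin (pi * (phi - a))).

Lemma is_derive_exp_arch t phi a :
  is_derive a 1
    (fun x : R =>
      expR (t * x) * (t * sin (pi * (phi - x)) + pi * cos (pi * (phi - x))))
    (exp_arch t phi a).
Proof.
apply: is_derive_eq; rewrite /exp_arch /GRing.scale /=; ring.
Qed.

Lemma continuous_exp_arch t phi : continuous (exp_arch t phi).
Proof.
move=> a; apply: differentiable_continuous; apply/derivable1_diffP.
exact: ex_derive.
Qed.

Lemma integral_exp_arch t phi :
  (\int[lebesgue_measure]_(a in `[(phi - 1)%R, phi]) (exp_arch t phi a)%:E =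
   (expR (t * phi) * (pi * (1 + expR (- t))))%:E)%E.
Proof.
pose F (x : R) : R :=
  expR (t * x) * (t * sin (pi * (phi - x)) + pi * cos (pi * (phi - x))).
have Fc (x : R) : {for x, continuous F}.
  apply: differentiable_continuous; apply/derivable1_diffP.
  by case: (is_derive_exp_arch t phi x).
rewrite (@continuous_FTC2 _ _ F) ?ltrBlDr ?ltrDl //.
- rewrite -EFinB; congr (_%:E).
  (* At both endpoints the sine vanishes, while the cosine is 1 at phi and -1 at phi - 1. *)
  rewrite /F subrr subKr !mulr0 mulr1 sin0 cos0 sinpi cospi mulrBr mulr1 expRD.
  rewrite mulr1; ring.
- apply: continuous_subspaceT => x; exact: continuous_exp_arch.
- split.
  + by move=> x _; case: (is_derive_exp_arch t phi x).
  + exact/cvg_at_right_filter/Fc.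
  + exact/cvg_at_left_filter/Fc.
- by move=> x _; rewrite derive1E; apply: derive_val; exact: is_derive_exp_arch.
Qed.

Let weight t a : R := (t ^+ 2 + pi ^+ 2) * expR (t * a).

Lemma exp_arch_restrict t phi :
  (fun a => (weight t a * sine_arch (phi - a))%:E) =
  (EFin \o exp_arch t phi) \_ `[(phi - 1)%R, phi]%classic.
Proof.
apply/funext => a; rewrite patchE sine_archE mem_setE in_itv /=.
rewrite subr_ge0 lerBlDr -lerBlDl [in RHS]andbC.
by case: ifP; rewrite ?mulr0 // /exp_arch /weight mulrA.
Qed.

Lemma integrable_exp_arch t phi :
  lebesgue_measure.-integrable setT
    (fun a => (weight t a * sine_arch (phi - a))%:E).
Proof.
rewrite exp_arch_restrict; apply: (proj1 (integrable_mkcond _ _)) => //.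
apply: continuous_compact_integrable; first exact: segment_compact.
apply: continuous_subspaceT => x; exact: continuous_exp_arch.
Qed.

Lemma integral_arch t phi :
  (\int[lebesgue_measure]_a (weight t a * sine_arch (phi - a))%:E =
   (expR (t * phi) * (pi * (1 + expR (- t))))%:E)%E.
Proof. by rewrite exp_arch_restrict -integral_mkcond integral_exp_arch. Qed.

Lemma integral_arch_sum t s :
  lebesgue_measure.-integrable setT
    (fun a => (weight t a * arch_sum s a)%:E) /\
  (\int[lebesgue_measure]_a (weight t a * arch_sum s a)%:E =
   (exp_sum t s * (pi * (1 + expR (- t))))%:E)%E.
Proof.
elim: s => [|x s [IHi IH]].
  rewrite /exp_sum big_nil mul0r.
  under eq_fun do rewrite /arch_sum big_nil mulr0.
  split; first exact: integrable0.
  exact: integral0.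
have E : (fun a => (weight t a * arch_sum (x :: s) a)%:E) =
    (fun a => (x.1)%:E * (weight t a * sine_arch (x.2 - a))%:E +
              (weight t a * arch_sum s a)%:E)%E.
  apply/funext => a; rewrite /arch_sum big_cons -EFinM -EFinD; congr (_%:E).
  ring.
have intx := integrableZl measurableT x.1 (integrable_exp_arch t x.2).
rewrite E; split; first exact: integrableD.
rewrite integralD // integralZl //; last exact: integrable_exp_arch.
rewrite integral_arch IH -EFinM -EFinD /exp_sum big_cons; congr (_%:E); ring.
Qed.

(** The coefficients in s may be negative; positivity comes from integrating the nonnegative
    function and dividing by pi (1 + e^(-t)) > 0. *)
Lemma exp_sum_ge0 t s : (forall a, 0 <= arch_sum s a) -> 0 <= exp_sum t s.
Proof.
move=> s0; have [_ E] := integral_arch_sum t s.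
have : (0 <= (exp_sum t s * (pi * (1 + expR (- t))))%:E)%E.
  rewrite -E; apply: integral_ge0 => a _; rewrite lee_fin mulr_ge0 //.
  by rewrite mulr_ge0 ?expR_ge0 // addr_ge0 ?sqr_ge0.
by rewrite lee_fin pmulr_lge0 // mulr_gt0 ?pi_gt0 // ltr_pwDr ?expR_gt0.
Qed.

(* Up to a factor depending only on t, the integral of e^(t a) f(a) is v. *)
Definition arch_transform t f v : Prop :=
  exists2 s, f =1 arch_sum s & v = exp_sum t s.

Lemma arch_transform_ge0 t f v :
  arch_transform t f v -> (forall a, 0 <= f a) -> 0 <= v.
Proof. by move=> [s fs ->] f0; apply: exp_sum_ge0 => a; rewrite -fs. Qed.

Lemma arch_transformD t f g v w : arch_transform t f v ->
  arch_transform t g w -> arch_transform t (fun a => f a + g a) (v + w).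
Proof.
move=> [s fs ->] [s' gs ->]; exists (s ++ s'); last by rewrite /exp_sum big_cat.
by move=> a; rewrite fs gs /arch_sum big_cat.
Qed.

Lemma arch_transformZ t c f v : arch_transform t f v ->
  arch_transform t (fun a => c * f a) (c * v).
Proof.
move=> [s fs ->]; exists [seq (c * x.1, x.2) | x <- s].
  move=> a; rewrite fs /arch_sum big_map mulr_sumr.
  by apply: eq_bigr => x _; rewrite mulrA.
rewrite /exp_sum big_map mulr_sumr.
by apply: eq_bigr => x _; rewrite mulrA.
Qed.

Lemma arch_transform_shift t d f v : arch_transform t f v ->
  arch_transform t (fun a => f (a + d)) (expR (- (t * d)) * v).
Proof.
move=> [s fs ->]; exists [seq (x.1, x.2 - d) | x <- s].
  move=> a; rewrite fs /arch_sum big_map.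
  by apply: eq_bigr => x _ /=; rewrite opprD addrA addrAC.
rewrite /exp_sum big_map mulr_sumr.
by apply: eq_bigr => x _ /=; rewrite mulrBr expRD; ring.
Qed.

Lemma arch_transform_sum t (I : Type) (r : seq I) (F : I -> R -> R)
    (V : I -> R) : (forall i, arch_transform t (F i) (V i)) ->
  arch_transform t (fun a => \sum_(i <- r) F i a) (\sum_(i <- r) V i).
Proof.
move=> FV; elim: r => [|i r [s Fs Vs]].
  exists [::]; last by rewrite /exp_sum !big_nil.
  by move=> a; rewrite /arch_sum !big_nil.
have [s' F' V'] := arch_transformD (FV i) (ex_intro2 _ _ s Fs Vs).
by exists s' => [a|]; rewrite big_cons -?V' // -F'.
Qed.

Lemma arch_transform_le t f g v w : arch_transform t f v ->
  arch_transform t g w -> (forall a, f a <= g a) -> v <= w.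
Proof.
move=> fv gw fg.
have := arch_transform_ge0 (arch_transformD gw (arch_transformZ (-1) fv)).
by rewrite mulN1r subr_ge0; apply=> a; rewrite mulN1r subr_ge0.
Qed.

End ArchTransform.

(** * Filtrations *)

Section Filtration.
Variables (R : realType) (k : fieldType) (D : triangulatedCategory k).
Variable sigma : preStability R D.
Implicit Types (X Y A B C E F : D) (a b t : R).

Lemma arch_transform_mass t E :
  arch_transform t (fun a => heart_height sigma a E) (mass sigma t E).
Proof.
exists [seq (charge_norm sigma x.1, x.2) | x <- HN_factors sigma E].
  by move=> a; rewrite heart_heightE /arch_sum big_map.
by rewrite /mass /exp_sum big_map.
Qed.

Lemma heart_height_le a Y : slice_le sigma a Y -> heart_height sigma a Y = 0.
Proof.
move=> leY; rewrite /heart_height !top_height_le ?addr0 //.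
by apply: slice_le_weaken leY; rewrite lerDl.
Qed.

(** Both truncations are all of X, and the charge heights at a and a + 1 are opposite. *)
Lemma heart_height_gt a X :
  slice_gt sigma (a + 1) X -> heart_height sigma a X = 0.
Proof.
move=> gtX; rewrite /heart_height !top_height_gt ?charge_heightD1 ?subrr //.
by apply: slice_gt_weaken gtX; rewrite lerDl.
Qed.

Lemma heart_height_subadditive a A B C (f : mor A B) (g : mor B C) h :
  exact_triangle f g h ->
  heart_height sigma a B <= heart_height sigma a A + heart_height sigma a C.
Proof.
move=> ex; rewrite addrACA.
by apply: lerD; exact: top_height_subadditive ex.
Qed.

Lemma heart_height_trunc_gt a b E : b <= a ->
  heart_height sigma a E <= heart_height sigma a (trunc_gt sigma b E).
Proof.
move=> ba; rewrite /trunc_gt; case: truncation => X Y i p h ex _ leY /=.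
have := heart_height_subadditive a ex.
by rewrite (heart_height_le (slice_le_weaken ba leY)) addr0.
Qed.

Lemma heart_height_trunc_le a b E : a + 1 <= b ->
  heart_height sigma a E <= heart_height sigma a (trunc_le sigma b E).
Proof.
move=> ab; rewrite /trunc_le; case: truncation => X Y i p h ex gtX _ /=.
have := heart_height_subadditive a ex.
by rewrite (heart_height_gt (slice_gt_weaken ab gtX)) add0r.
Qed.

(** * The defect of subadditivity on a fibre triangle *)

Definition fib_defect a A B C : R :=
  top_height sigma a A + top_height sigma a C - top_height sigma a B.

Lemma fib_defectE a A B C :
  heart_height sigma a A + heart_height sigma a C =
  heart_height sigma a B + (fib_defect a A B C + fib_defect (a + 1) A B C).
Proof. by rewrite /heart_height /fib_defect; ring. Qed.

Lemma is_fib_exact A B C (f : mor B C) : is_fib f A ->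
  exists (g : mor C (shift_obj A)) (h : mor (shift_obj A) (shift_obj B)),
    exact_triangle f g h.
Proof.
move=> [T [[g [h ex]] /isomorphic_shift AT]].
have [w wi] := isomorphic_sym (isomorphic_trans AT (unshift_objK T)).
have [w' [w'w ww']] := wi.
exists (w \oc g), (h \oc w').
apply: (exact_iso (is_iso_idm B) (is_iso_idm C) wi _ _ _ ex).
- by rewrite compm_idl compm_idr.
- by rewrite compm_idr.
- by rewrite shift_mor_id compm_idl -compmA w'w compm_idr.
Qed.

Section FibDefect.
Variables (A B C : D) (f : mor B C).
Hypothesis fA : is_fib f A.

Lemma fib_defect_ge0 a : 0 <= fib_defect a A B C.
Proof.
have [g [h ex]] := is_fib_exact fA.
have := top_height_subadditive sigma (a + 1) (exact_rotate (exact_rotate ex)).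
by rewrite !top_height_shift /fib_defect subr_ge0.
Qed.

(** Subadditivity for C -> A[1] -> B[1] at a + 1 bounds g_a(A) by g_{a+1}(C) + g_a(B). *)
Lemma fib_defect_le_base a : fib_defect a A B C <= heart_height sigma a C.
Proof.
have [g [h ex]] := is_fib_exact fA.
have := top_height_subadditive sigma (a + 1) (exact_rotate ex).
rewrite !top_height_shift /fib_defect /heart_height; lra.
Qed.

(** Subadditivity for B -> C -> A[1] at a bounds g_a(C) by g_a(B) + g_{a-1}(A). *)
Lemma fib_defect_le_fib a : fib_defect a A B C <= heart_height sigma (a - 1) A.
Proof.
have [g [h ex]] := is_fib_exact fA.
have := top_height_subadditive sigma a ex.
rewrite /fib_defect /heart_height -{3}(subrK 1 a) top_height_shift subrK; lra.
Qed.

Lemma heart_height_fib a :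
  heart_height sigma a B <= heart_height sigma a A + heart_height sigma a C.
Proof. by rewrite (fib_defectE a A B C) lerDl addr_ge0 ?fib_defect_ge0. Qed.

End FibDefect.

(** * Comparison along the filtration *)

Variables (n : nat) (eps : R) (a : nat -> R).
Hypothesis eps_ge0 : 0 <= eps.
Hypothesis a_incr : forall i j, (1 <= i)%N -> (i < j)%N -> (j < n)%N -> a i < a j.
Variables (E : nat -> D) (p : forall i, mor (E i) (E i.-1)).
Hypothesis E0 : is_zero (E 0%N).
Variable F : nat -> D.
Hypothesis F_fib : forall i, (1 <= i <= n)%N -> is_fib (p i) (F i).

Let low j := trunc_le sigma (a j) (F j.+1).
Let high j := trunc_gt sigma (a j - eps) (F j).

Lemma heart_height_filtration b m : (m <= n)%N ->
  heart_height sigma b (E m) <= \sum_(1 <= i < m.+1) heart_height sigma b (F i).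
Proof.
elim: m => [_|m IH mn].
  by rewrite big_geq // heart_height_le //; left.
rewrite big_nat_recr //= addrC.
apply: le_trans (heart_height_fib (F_fib _) b) _; first by rewrite mn.
by rewrite lerD2l IH // ltnW.
Qed.

(** Each summand bounds the defect on one side of b = a_j. Adding them gives a bound valid for every
    b that is still a combination of translated arches, which a case distinction on b would not
    be. *)
Definition jump_bound j b : R :=
  heart_height sigma (b - 1) (low j) +
  \sum_(1 <= l < n) heart_height sigma b (high l).

Lemma fib_defect_jump j b : (1 <= j < n)%N ->
  fib_defect b (F j.+1) (E j.+1) (E j) <= jump_bound j b.
Proof.
move=> /andP[j1 jn]; have Fj := F_fib (i := j.+1) jn.
have low0 : 0 <= heart_height sigma (b - 1) (low j) by exact: heart_height_ge0.
(* For b <= a_j, N_{b-1} sees only phases in [b - 1, b], so F_{j+1} may be replaced by its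
   truncation below a_j. *)
have [ba|ab] := leP b (a j).
  rewrite /jump_bound ler_wpDr //.
    by apply: sumr_ge0 => l _; exact: heart_height_ge0.
  apply: le_trans (fib_defect_le_fib Fj b) _.
  by apply: heart_height_trunc_le; rewrite subrK.
(* For b > a_j, N_b(E_j) is at most the sum of the N_b(F_l) with l <= j, and a_l - eps <= a_j < b
   allows F_l to be replaced by [high l]. *)
rewrite /jump_bound ler_wpDl //.
apply: le_trans (fib_defect_le_base Fj b) _.
apply: le_trans (heart_height_filtration b (ltnW jn)) _.
rewrite [leRHS](big_cat_nat (n := j.+1)) //= ler_wpDr //.
  by apply: sumr_ge0 => l _; exact: heart_height_ge0.
apply: ler_sum_nat => l /andP[l1]; rewrite ltnS => lj.
apply: heart_height_trunc_gt; apply: (@le_trans _ _ (a j)); last exact: ltW.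
apply: (@le_trans _ _ (a l)); first by rewrite gerBl.
by move: lj; rewrite leq_eqVlt => /predU1P[->//|lj]; exact/ltW/a_incr.
Qed.

Lemma heart_height_factors b m : (1 <= m <= n)%N ->
  \sum_(1 <= i < m.+1) heart_height sigma b (F i) <=
  heart_height sigma b (E m) +
  \sum_(1 <= j < m) (jump_bound j b + jump_bound j (b + 1)).
Proof.
case: m => // m /= mn; elim: m mn => [|m IH] mn.
  (* The first triangle has base E_0 = 0, so its defects are at most N(E_0) = 0 and add no term to
     the sum over j. *)
  rewrite big_nat1 big_geq // addr0.
  have hE0 c : heart_height sigma c (E 0) = 0 by rewrite heart_height_le //; left.
  have := fib_defectE b (F 1) (E 1) (E 0); rewrite hE0 addr0 => ->.
  have Fb c : fib_defect c (F 1) (E 1) (E 0) <= 0.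
    by rewrite -(hE0 c); apply: fib_defect_le_base; exact: F_fib.
  have := Fb b; have := Fb (b + 1); lra.
rewrite big_nat_recr //= [X in _ <= _ + X]big_nat_recr //=.
have := IH (ltnW mn).
have := fib_defectE b (F m.+2) (E m.+2) (E m.+1).
have := fib_defect_jump b (j := m.+1) mn.
have := fib_defect_jump (b + 1) (j := m.+1) mn.
lra.
Qed.

Lemma mass_filtration_le t :
  mass sigma t (E n) <= \sum_(1 <= i < n.+1) mass sigma t (F i).
Proof.
apply: (arch_transform_le (arch_transform_mass t (E n))).
  by apply: arch_transform_sum => i; exact: arch_transform_mass.
by move=> b; exact: heart_height_filtration.
Qed.

(** Transform of [heart_height_factors]: translating the argument by -1 produces the factor e^t, and
    by 1 the factor e^(-t). *)
Lemma mass_factors_le t : (1 <= n)%N ->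
  \sum_(1 <= i < n.+1) mass sigma t (F i) <=
  mass sigma t (E n) +
  \sum_(1 <= j < n)
    ((expR t * mass sigma t (low j) + \sum_(1 <= l < n) mass sigma t (high l)) +
     (mass sigma t (low j) +
      expR (- t) * \sum_(1 <= l < n) mass sigma t (high l))).
Proof.
move=> n1; apply: (@arch_transform_le _ t).
- by apply: arch_transform_sum => i; exact: arch_transform_mass.
- apply: arch_transformD; first exact: arch_transform_mass.
  apply: arch_transform_sum => j.
  have high_transform : arch_transform t
      (fun b => \sum_(1 <= l < n) heart_height sigma b (high l))
      (\sum_(1 <= l < n) mass sigma t (high l)).
    by apply: arch_transform_sum => l; exact: arch_transform_mass.
  apply: arch_transformD; apply: arch_transformD.
  + have := arch_transform_shift (-1) (arch_transform_mass t (low j)).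
    by rewrite mulrN1 opprK; exact.
  + exact: high_transform.
  + exact: arch_transform_mass.
  + have := arch_transform_shift 1 high_transform.
    by rewrite mulr1; exact.
- move=> b /=; have := heart_height_factors b (m := n).
  rewrite n1 leqnn => /(_ isT); rewrite /jump_bound.
  by under [X in _ <= _ + X -> _]eq_bigr do rewrite addrK.
Qed.

End Filtration.

(** * The two inequalities with an explicit constant *)

Theorem theorem6p1 (R : realType) (n : nat) (n_ge1 : (1 <= n)%N) (eps t : R)
    (eps01 : 0 < eps < 1) :
  exists C : R, 0 < C /\
  forall (k : fieldType) (D : triangulatedCategory k)
      (sigma : preStability R D) (a : nat -> R)
      (a_incr : forall i j, (1 <= i)%N -> (i < j)%N -> (j < n)%N -> a i < a j)
      (E : nat -> D) (p : forall i, mor (E i) (E i.-1)) (E0 : is_zero (E 0%N))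
      (F : nat -> D)
      (F_fib : forall i, (1 <= i <= n)%N -> is_fib (p i) (F i)),
    mass sigma t (E n) <= \sum_(1 <= i < n.+1) mass sigma t (F i) /\
    \sum_(1 <= i < n.+1) mass sigma t (F i) <=
      mass sigma t (E n) +
      C * \sum_(1 <= j < n)
            (mass sigma t (trunc_le sigma (a j) (F j.+1)) +
             mass sigma t (trunc_gt sigma (a j - eps) (F j))).
Proof.
have e0 := expR_gt0 t; have eN0 := expR_gt0 (- t).
(* Lower truncations enter with coefficient 1 + e^t. Upper ones enter with (n - 1)(1 + e^(-t)), as
   the whole sum over l occurs for each of the n - 1 indices j. The constant dominates both. *)
exists (n%:R * (1 + expR t + expR (- t))); split.
  by rewrite mulr_gt0 ?ltr0n // addr_gt0 // ltr_pwDl.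
move=> k D sigma a a_incr E p E0 F F_fib; split.
  exact: (mass_filtration_le sigma E0 F_fib).
have eps_ge0 : 0 <= eps by case/andP: eps01 => /ltW.
apply: le_trans (mass_factors_le sigma eps_ge0 a_incr E0 F_fib t n_ge1) _.
rewrite lerD2l.
set L := fun j => mass sigma t (trunc_le sigma (a j) (F j.+1)).
set U := fun j => mass sigma t (trunc_gt sigma (a j - eps) (F j)).
have mass_ge0 X : 0 <= mass sigma t X.
  by apply: (arch_transform_ge0 (arch_transform_mass sigma t X)) => b;
    exact: heart_height_ge0.
have L0 : 0 <= \sum_(1 <= j < n) L j by apply: sumr_ge0 => j _; exact: mass_ge0.
have U0 : 0 <= \sum_(1 <= j < n) U j by apply: sumr_ge0 => j _; exact: mass_ge0.
rewrite !big_split /= -!mulr_sumr !sumr_const_nat -/L -/U.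
move: (\sum_(1 <= j < n) L j) (\sum_(1 <= j < n) U j) L0 U0 => SL SU L0 U0.
rewrite -(mulr_natl SU).
have n1 : (n - 1)%:R <= n%:R :> R by rewrite ler_nat leq_subr.
have nR : 1 <= n%:R :> R by rewrite ler1n.
have h1 : (n - 1)%:R * SU <= n%:R * SU by exact: ler_wpM2r.
have h2 : (n - 1)%:R * (expR (- t) * SU) <= n%:R * (expR (- t) * SU).
  by apply: ler_wpM2r => //; rewrite mulr_ge0 // ltW.
have h3 : SL <= n%:R * SL by rewrite ler_peMl.
have h4 : expR t * SL <= n%:R * (expR t * SL).
  by rewrite ler_peMl // mulr_ge0 // ltW.
have h5 : 0 <= n%:R * (expR t * SU) by rewrite !mulr_ge0 // ltW.
have h6 : 0 <= n%:R * (expR (- t) * SL) by rewrite !mulr_ge0 // ltW.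
lra.
Qed.
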